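(* Let $\lambda$ be a partition and let $\mathcal{S}$ and $\mathcal{T}$ be sets consisting of $m$ and $n$ variables, respectively. If $\Delta(\mathcal{S};\mathcal{T}) \neq 0$, then $$\mathfrak{s}_\lambda(\mathcal{S}\cup\mathcal{T}) = \sum_{\substack{\mu,\nu:\\ \mu\star_{m,n}\nu=\lambda}} \frac{\varepsilon_{m,n}(\mu,\nu)\,\mathfrak{s}_\mu(\mathcal{S})\,\mathfrak{s}_\nu(\mathcal{T})}{\Delta(\mathcal{S};\mathcal{T})},$$ where the sum is over all pairs of partitions $\mu,\nu$ (of length at most $m$ and $n$, respectively) whose $(m,n)$-overlap is $\lambda$.
   Context: Sets of variables are viewed as finite sequences (of elements of a field, e.g. indeterminates or complex numbers) in a fixed order; repetitions are allowed unless excluded. The union $\mathcal{A}\cup\mathcal{B}$ of two sequences is obtained by appending $\mathcal{B}$ to $\mathcal{A}$; sums of sequences are elementwise. $\Delta(\mathcal{X}) = \prod_{i<j}(\mathcal{X}_i-\mathcal{X}_j)$ and $\Delta(\mathcal{X};\mathcal{Y}) = \prod_{x\in\mathcal{X},y\in\mathcal{Y}}(x-y)$. A partition is a non-increasing sequence of non-negative integers; partitions differing only by trailing zeros are equal; its length $l(\lambda)$ is the number of positive parts. When used as a sequence of prescribed length, a partition is padded with zeros. Schur functions: for $\mathcal{X}$ of length $N$, $\mathfrak{s}_\lambda(\mathcal{X})=0$ if $l(\lambda)>N$, and otherwise $\mathfrak{s}_\lambda(\mathcal{X}) = \det(x^{\lambda_j+N-j})_{x\in\mathcal{X},1\le j\le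 N}/\Delta(\mathcal{X})$ (extended as a polynomial to repeated variables). Overlap: $\rho_n=(n-1,\dots,1,0)$ ($\rho_0$ is empty). For partitions $\mu,\nu$ of length at most $m$ and $n$, respectively, the $(m,n)$-overlap $\mu\star_{m,n}\nu$ is the partition (of length at most $m+n$) such that $\mu\star_{m,n}\nu+\rho_{m+n}$ equals $(\mu+\rho_m)\cup(\nu+\rho_n)$ up to reordering, if it exists; otherwise $\mu\star_{m,n}\nu=\infty$, a symbol that is not a partition. If the overlap is a partition, $\varepsilon_{m,n}(\mu,\nu)$ is the sign of the permutation sorting $(\mu+\rho_m)\cup(\nu+\rho_n)$ into the strictly decreasing sequence $\mu\star_{m,n}\nu+\rho_{m+n}$; otherwise $\varepsilon_{m,n}(\mu,\nu)=1$. *)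

(* Defs.v *)
From HB Require Import structures.
From mathcomp Require Import all_boot all_order all_fingroup all_algebra.
From mathcomp Require Import boolp classical_sets cardinality fsbigop.
From mathcomp Require Import mpoly zify.

Set Implicit Arguments.
Unset Strict Implicit.
Unset Printing Implicit Defensive.

Import GRing.Theory.
Local Open Scope ring_scope.

(* A partition is represented by its list of positive parts, so that partitions
   differing only by trailing zeros are identified and the length l(lambda)
   is [size lambda]. *)
Definition is_partition (s : seq nat) : bool := sorted geq s && (0 \notin s)%N.

Record int_partition := IntPartition { parts :> seq nat; _ : is_partition parts }.

HB.instance Definition _ := [isSub for parts].
HB.instance Definition _ := [Choice of int_partition by <:].

(* lambda + rho_N with rho_N = (N - 1, ..., 1, 0), where lambda is padded with
   zeros to length N; only meaningful when l(lambda) <= N. *)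
Definition add_rho (N : nat) (lam : int_partition) : N.-tuple nat :=
  [tuple (nth 0%N lam i + (N - i.+1))%N | i < N].

(* Delta(X) and, below, Delta(X; Y) *)
Definition vdm (R : comNzRingType) (N : nat) (X : N.-tuple R) : R :=
  \prod_(i < N) \prod_(j < N | (i < j)%N) (tnth X i - tnth X j).

Definition vdm2 (R : comNzRingType) (m n : nat)
    (X : m.-tuple R) (Y : n.-tuple R) : R :=
  \prod_(i < m) \prod_(j < n) (tnth X i - tnth Y j).

Definition alternant (R : comNzRingType) (N : nat) (e : N.-tuple nat)
    (X : N.-tuple R) : R :=
  \det (\matrix_(i < N, j < N) (tnth X i ^+ tnth e j)).

Definition indeterminates (F : fieldType) (N : nat) : N.-tuple {mpoly F[N]} :=
  [tuple 'X_i | i < N].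

Lemma det_rho_vdm (R : comNzRingType) (N : nat) (X : N.-tuple R) :
  \det (\matrix_(i < N, j < N) (tnth X i ^+ (N - j.+1))) = vdm X.
Proof.
pose a : 'rV[R]_N := \row_j tnth X (rev_ord j).
pose s : 'S_N := perm (@rev_ord_inj N).
have -> : (\matrix_(i < N, j < N) (tnth X i ^+ (N - j.+1)))
          = row_perm s (col_perm s (Vandermonde N a)^T).
  apply/matrixP=> i j; rewrite !mxE !permE /=.
  by rewrite rev_ordK.
rewrite row_permE col_permE !det_mulmx det_tr det_Vandermonde.
rewrite !det_perm odd_permV mulrCA -signr_addb addbb expr0 mulr1.
rewrite /vdm [RHS](exchange_big_dep predT) //= [RHS](reindex_inj rev_ord_inj) /=.
apply: eq_bigr => i _; rewrite (reindex_inj rev_ord_inj) /=.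
apply: eq_big => [j|j _].
  by have := ltn_ord i; have := ltn_ord j; rewrite /=; lia.
by rewrite !mxE rev_ordK.
Qed.

(* Delta(X) divides every alternant: reduce x ^ e modulo the monic polynomial
   with root sequence X. *)
Lemma vdm_dvd_alternant (R : comNzRingType) (N : nat) (e : N.-tuple nat)
    (X : N.-tuple R) : exists c : R, c * vdm X = alternant e X.
Proof.
pose P := \prod_(i < N) ('X - (tnth X i)%:P).
have Pmon : P \is monic by apply: monic_prod_XsubC.
have sP : size P = N.+1.
  by rewrite /P size_prod_XsubC /index_enum -enumT size_enum_ord.
pose r k := Pdiv.CommonRing.rmodp 'X^k P : {poly R}.
exists (\det (\matrix_(k < N, j < N) (r (tnth e j))`_(N - k.+1))).
rewrite mulrC -det_rho_vdm -det_mulmx /alternant; congr (\det _).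
apply/matrixP=> i j; rewrite !mxE.
have rt : P.[tnth X i] = 0.
  rewrite /P horner_prod (bigD1 i) //= hornerXsubC subrr mul0r //.
have sr : (size (r (tnth e j)) <= N)%N.
  by rewrite -ltnS -sP Pdiv.CommonRing.ltn_rmodpN0 // monic_neq0.
have := congr1 (fun p => p.[tnth X i]) (Pdiv.RingMonic.rdivp_eq Pmon 'X^(tnth e j)).
rewrite hornerXn hornerD hornerM rt mulr0 add0r => ->.
rewrite (horner_coef_wide _ sr) (reindex_inj rev_ord_inj) /=.
apply: eq_bigr => k _; rewrite !mxE mulrC.
by have -> : (N - (rev_ord k).+1 = k)%N by have := ltn_ord k; rewrite /=; lia.
Qed.

Lemma schur_poly_subproof (F : fieldType) (N : nat) (lam : int_partition) :
  exists p : {mpoly F[N]},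
    p * vdm (indeterminates F N)
      == alternant (add_rho N lam) (indeterminates F N).
Proof.
by have [c /eqP] := vdm_dvd_alternant (add_rho N lam) (indeterminates F N); exists c.
Qed.

(* The quotient det(x_i ^ (lambda_j + N - j)) / Delta(x_1, ..., x_N) as a
   polynomial in N indeterminates. *)
Definition schur_poly (F : fieldType) (N : nat) (lam : int_partition) :
    {mpoly F[N]} :=
  xchoose (schur_poly_subproof F N lam).

Definition schur (F : fieldType) (N : nat) (lam : int_partition)
    (X : N.-tuple F) : F :=
  if (size lam <= N)%N then (schur_poly F N lam).@[tnth X] else 0.

Definition rho_union (m n : nat) (mu nu : int_partition) : (m + n).-tuple nat :=
  [tuple of add_rho m mu ++ add_rho n nu].

Definition is_overlap (m n : nat) (mu nu lam : int_partition) : bool :=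
  (size lam <= m + n)%N && perm_eq (add_rho (m + n) lam) (rho_union m n mu nu).

(* The (m, n)-overlap; [None] stands for the symbol infinity. *)
Definition overlap (m n : nat) (mu nu : int_partition) : option int_partition :=
  if pselect (exists lam, is_overlap m n mu nu lam) is left ex
  then Some (xchoose ex) else None.

(* When the overlap is a partition, the sorting permutation exists and is
   unique, so the default value [1%g] is never used. *)
Definition overlap_sign (m n : nat) (mu nu : int_partition) : int :=
  if overlap m n mu nu is Some lam then
    (-1) ^+ odd_perm (odflt 1%g [pick s : 'S_(m + n) |
      [tuple tnth (rho_union m n mu nu) (s i) | i < m + n]
        == add_rho (m + n) lam])
  else 1.

(* This set is finite ([finite_overlap_pairs] below), so a finitely supported
   sum over it is the usual sum. *)
Definition overlap_pairs (m n : nat) (lam : int_partition) :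
    set (int_partition * int_partition) :=
  [set p : int_partition * int_partition |
    [/\ (size p.1 <= m)%N, (size p.2 <= n)%N & overlap m n p.1 p.2 = Some lam]].

Lemma partition_nth_inj (N : nat) (lam mu : int_partition) :
  (size lam <= N)%N -> (size mu <= N)%N ->
  add_rho N lam = add_rho N mu -> lam = mu.
Proof.
move=> sl sm E.
have nthE i : nth 0%N lam i = nth 0%N mu i.
  have [lt|le] := ltnP i N; last first.
    by rewrite !nth_default // (leq_trans _ le).
  have := congr1 (fun t => tnth t (Ordinal lt)) E.
  by rewrite !tnth_mktuple /= => /addIn.
have pos (s : int_partition) i : (i < size s)%N = (nth 0%N s i != 0%N).
  case: s => s /= /andP[_ s0]; have [lt|le] := ltnP i (size s).
    by apply/esym; apply: contraNneq s0 => <-; rewrite mem_nth.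
  by rewrite nth_default.
apply/val_inj => /=; apply: (@eq_from_nth _ 0%N) => //.
have := pos lam (size mu); have := pos mu (size lam).
have := pos lam (size lam); have := pos mu (size mu).
by rewrite !nthE; lia.
Qed.

Lemma add_rho_sorted (N : nat) (lam : int_partition) : sorted gtn (add_rho N lam).
Proof.
apply/(sortedP 0%N) => i; rewrite size_tuple => lt.
have lt' : (i < N)%N by apply: ltnW.
have nthE k (ltk : (k < N)%N) :
    nth 0%N (add_rho N lam) k = (nth 0%N lam k + (N - k.+1))%N.
  exact: (nth_mktuple (fun i : 'I_N => (nth 0%N lam i + (N - i.+1))%N) 0%N (Ordinal ltk)).
rewrite !nthE //=.
suff : (nth 0%N lam i.+1 <= nth 0%N lam i)%N by lia.
have [ls|] := ltnP i.+1 (size lam); last by move=> ?; rewrite nth_default.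
by have /andP[/(sortedP 0%N) h _] := valP lam; apply: h.
Qed.

Lemma overlapP (m n : nat) (mu nu lam : int_partition) :
  overlap m n mu nu = Some lam <-> is_overlap m n mu nu lam.
Proof.
rewrite /overlap; case: pselect => [ex|nex]; last first.
  by split=> // h; case: nex; exists lam.
have ov := xchooseP ex; split=> [[<-] //|h]; congr Some.
case/andP: ov h => s1 p1 /andP[s2 p2].
apply: (partition_nth_inj s1 s2); apply/val_inj => /=.
apply: (@sorted_eq _ gtn); try exact: add_rho_sorted.
- by move=> x y z /= xy yz; apply: ltn_trans yz xy.
- by move=> x y /= ; lia.
- by rewrite (perm_trans p1) // perm_sym.
Qed.

Lemma finite_overlap_pairs (m n : nat) (lam : int_partition) :
  finite_set (overlap_pairs m n lam).
Proof.
pose B := (\max_(x <- add_rho (m + n) lam) x).+1.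
pose f (p : int_partition * int_partition) : m.-tuple 'I_B * n.-tuple 'I_B :=
  (map_tuple inord (add_rho m p.1), map_tuple inord (add_rho n p.2)).
have bnd p : p \in overlap_pairs m n lam ->
    all (gtn B) (add_rho m p.1) && all (gtn B) (add_rho n p.2).
  rewrite inE => -[_ _ /overlapP/andP[_ /perm_all h]].
  rewrite -all_cat -(h (gtn B)); apply/allP => x xin /=.
  by rewrite ltnS; apply: leq_bigmax_seq.
have inK k (t u : k.-tuple nat) : all (gtn B) t -> all (gtn B) u ->
    map_tuple (@inord B.-1) t = map_tuple inord u -> t = u.
  move=> /all_tnthP ht /all_tnthP hu E; apply: eq_from_tnth => i.
  have := congr1 (fun v => val (tnth v i)) E.
  by rewrite !tnth_map /= !inordK ?(ht i) ?(hu i) //; [exact: (hu i)|exact: (ht i)].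
have inj : {in overlap_pairs m n lam &, injective f}.
  move=> [p1 p2] [q1 q2] hp hq [/= E1 E2].
  have /andP[/= bp1 bp2] := bnd _ hp; have /andP[/= bq1 bq2] := bnd _ hq.
  move: hp hq; rewrite !inE => -[/= sp1 sp2 _] -[/= sq1 sq2 _].
  by congr pair; [apply: (partition_nth_inj sp1 sq1); apply: inK => //; apply/val_inj
                 |apply: (partition_nth_inj sp2 sq2); apply: inK => //; apply/val_inj].
by rewrite -(eq_finite_set (inj_card_eq inj)); exact: finite_finset.
Qed.

(* Main.v *)
(* Laplace expansion of the alternant of lambda along the block of the first m
   rows: each choice of m columns is a splitting of lambda + rho_{m+n} into
   mu + rho_m and nu + rho_n, that is, a pair (mu, nu) with overlap lambda.
   Since Delta(S u T) = Delta(S) Delta(T) Delta(S; T), dividing by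
   Delta(S) Delta(T) gives the formula.  The division is done for indeterminates,
   where the Vandermonde products do not vanish, and the resulting polynomial
   identity is then specialised to S and T, which may have repetitions. *)
Require Import Defs.
From mathcomp Require Import all_boot all_order all_fingroup all_algebra.
From mathcomp Require Import finmap boolp classical_sets cardinality fsbigop.
From mathcomp Require Import mpoly zify.

Set Implicit Arguments.
Unset Strict Implicit.
Unset Printing Implicit Defensive.

Import GRing.Theory.
Local Open Scope ring_scope.

(** * Vandermonde products and Schur polynomials under substitution *)

Lemma rmorph_vdm (R R' : comNzRingType) (f : {rmorphism R -> R'}) (N : nat)
    (X : N.-tuple R) : f (vdm X) = vdm (map_tuple f X).
Proof.
rewrite /vdm rmorph_prod; apply: eq_bigr => i _.
by rewrite rmorph_prod; apply: eq_bigr => j _; rewrite rmorphB !tnth_map.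
Qed.

Lemma rmorph_vdm2 (R R' : comNzRingType) (f : {rmorphism R -> R'}) (m n : nat)
    (X : m.-tuple R) (Y : n.-tuple R) :
  f (vdm2 X Y) = vdm2 (map_tuple f X) (map_tuple f Y).
Proof.
rewrite /vdm2 rmorph_prod; apply: eq_bigr => i _.
by rewrite rmorph_prod; apply: eq_bigr => j _; rewrite rmorphB !tnth_map.
Qed.

Lemma rmorph_alternant (R R' : comNzRingType) (f : {rmorphism R -> R'})
    (N : nat) (e : N.-tuple nat) (X : N.-tuple R) :
  f (alternant e X) = alternant e (map_tuple f X).
Proof.
rewrite /alternant -det_map_mx; congr (\det _); apply/matrixP=> i j.
by rewrite !mxE rmorphXn tnth_map.
Qed.

Lemma vdm_cat (R : comNzRingType) (m n : nat) (X : m.-tuple R) (Y : n.-tuple R) :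
  vdm [tuple of X ++ Y] = vdm X * vdm Y * vdm2 X Y.
Proof.
rewrite /vdm big_split_ord /= mulrAC; congr (_ * _).
  rewrite -big_split; apply: eq_bigr => i _; rewrite big_split_ord /=.
  congr (_ * _); apply: eq_big => j; rewrite ?tnth_lshift ?tnth_rshift //=.
  by have := ltn_ord i; lia.
apply: eq_bigr => i _; rewrite big_split_ord /=.
(* For a row index [m + i], no column index [j < m] lies above it, so this factor is an empty
   product. *)
rewrite [X in X * _]big_pred0 => [|j]; last by have := ltn_ord j; lia.
by rewrite mul1r; apply: eq_big => j; rewrite ?tnth_rshift //= ltn_add2l.
Qed.

Lemma vdm_indeterminates_neq0 (F : fieldType) (N : nat) :
  vdm (indeterminates F N) != 0.
Proof.
apply/prodf_neq0 => i _; apply/prodf_neq0 => j lt_ij.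
rewrite !tnth_mktuple subr_eq0; apply/eqP => /(congr1 (mcoeff U_(i))).
rewrite !mcoeffXU eqxx; have -> : (j == i) = false by exact: gtn_eqF.
by apply/eqP; rewrite oner_eq0.
Qed.

(** Substitution in the defining identity of [schur_poly]. No division occurs, so this holds even
    when [vdm X] vanishes. *)
Lemma schur_poly_comp (F : fieldType) (N k : nat) (lam : int_partition)
    (X : N.-tuple {mpoly F[k]}) :
  (schur_poly F N lam \mPo X) * vdm X = alternant (add_rho N lam) X.
Proof.
have /eqP/(congr1 (comp_mpoly X)) := xchooseP (schur_poly_subproof F N lam).
rewrite rmorphM rmorph_vdm rmorph_alternant.
have -> // : map_tuple (comp_mpoly X) (indeterminates F N) = X.
by apply: eq_from_tnth => i; rewrite tnth_map tnth_mktuple comp_mpolyXU -tnth_nth.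
Qed.

(** The bound on the length excludes the case where [schur] is 0 by convention while [schur_poly] is
    built from a truncation of [lam]. *)
Lemma meval_schur_poly_comp (F : fieldType) (N k : nat) (lam : int_partition)
    (X : N.-tuple {mpoly F[k]}) (v : 'I_k -> F) : (size lam <= N)%N ->
  (schur_poly F N lam \mPo X).@[v] = schur lam (map_tuple (meval v) X).
Proof.
move=> sl; rewrite /schur sl comp_mpoly_meval.
by apply: meval_eq => i; rewrite tnth_map.
Qed.

(** * Partitions as sets of distinct exponents *)

Lemma add_rho_uniq (N : nat) (lam : int_partition) : uniq (add_rho N lam).
Proof.
apply: (sorted_uniq _ _ (add_rho_sorted N lam)) => [x y z /= xy yz|x] /=.
  exact: ltn_trans yz xy.
by rewrite ltnn.
Qed.

Lemma eq_add_rho_mem (N : nat) (lam mu : int_partition) :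
    (size lam <= N)%N -> (size mu <= N)%N ->
  add_rho N lam =i add_rho N mu -> lam = mu.
Proof.
move=> sl sm E; apply: (partition_nth_inj sl sm); apply/val_inj => /=.
apply: (@irr_sorted_eq _ gtn) => //; try exact: add_rho_sorted.
- by move=> x y z /= xy yz; apply: ltn_trans yz xy.
- by move=> x /=; rewrite ltnn.
Qed.

(** The zeros of a non-increasing list form its tail, and reading past the end returns the default
    0. *)
Lemma nth_filter_neq0 (s : seq nat) (i : nat) : sorted geq s ->
  nth 0%N [seq x <- s | x != 0%N] i = nth 0%N s i.
Proof.
elim: s i => [|x s IH] i //=; rewrite path_sortedE; last first.
  by move=> y z t /= yz zt; apply: leq_trans zt yz.
case/andP=> /allP lex /IH {}IH; case: eqP => [x0|_]; last by case: i.
have s0 y : y \in s -> y = 0%N by move=> /lex /=; lia.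
rewrite (@eq_in_filter _ _ pred0) ?filter_pred0; last by move=> y /s0 ->.
case: i => [|i] /=; first by rewrite x0.
have [lt|le] := ltnP i (size s); last by rewrite !nth_default.
by rewrite [RHS]s0 ?mem_nth // nth_nil.
Qed.

(** Sort decreasingly and subtract [rho_N]: strict decrease of the sorted list makes the differences
    non-increasing. *)
Lemma perm_add_rho (N : nat) (s : N.-tuple nat) : uniq s ->
  exists2 mu : int_partition, (size mu <= N)%N & perm_eq s (add_rho N mu).
Proof.
move=> us; pose t := sort geq s.
have pt : perm_eq t s by rewrite perm_sort.
have st : size t = N by rewrite size_sort size_tuple.
have tdec : sorted gtn t.
  have : sorted geq t by apply: sort_sorted => x y; apply: leq_total.
  have : uniq t by rewrite (perm_uniq pt).
  move=> /(uniqP 0%N) ut /(sortedP 0%N) ht; apply/(sortedP 0%N) => i lti.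
  have := ht i lti; rewrite /= ltn_neqAle => ->; rewrite andbT.
  by apply/eqP => /ut E; have := E lti (ltnW lti); lia.
pose a i := (nth 0%N t i - (N - i.+1))%N.
(* This bound makes the truncated subtraction in [a] exact. The induction runs from the last index
   backwards. *)
have tge i : (i < N)%N -> (N - i.+1 <= nth 0%N t i)%N.
  move=> lti; have [k] : exists k, (k + i.+1 = N)%N by exists (N - i.+1)%N; lia.
  elim: k i {lti} => [|k IH] i E; first lia.
  have := IH i.+1; move/(sortedP 0%N)/(_ i): tdec; rewrite st /=; lia.
pose l := [seq x <- mkseq a N | x != 0%N].
have asort : sorted geq (mkseq a N).
  apply/(sortedP 0%N) => i; rewrite size_mkseq => lti.
  rewrite !nth_mkseq ?(ltnW lti) //= /a.
  by move/(sortedP 0%N)/(_ i): tdec; rewrite st /=; have := tge i.+1; lia.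
have lpart : is_partition l.
  rewrite /is_partition mem_filter eqxx andbT.
  by apply: sorted_filter asort => x y z /= xy yz; apply: leq_trans yz xy.
exists (IntPartition lpart).
  by rewrite /= size_filter (leq_trans (count_size _ _)) // size_mkseq.
rewrite perm_sym; have -> // : add_rho N (IntPartition lpart) = t :> seq nat.
apply: (@eq_from_nth _ 0%N); rewrite size_tuple ?st // => i lti.
rewrite (nth_mktuple _ 0%N (Ordinal lti)) /= nth_filter_neq0 // nth_mkseq //.
by rewrite /a subnK // tge.
Qed.

Lemma uniq_tuple_mem_eq (T : eqType) (N : nat) (s t : N.-tuple T) :
  uniq s -> {subset s <= t} -> s =i t.
Proof.
by move=> us st; have [|_ //] := uniq_min_size us st; rewrite !size_tuple.
Qed.

(** * Expansion of the alternant along the first [m] rows *)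

Section Laplace.
Variables (R : comNzRingType) (m n : nat) (lam : int_partition).
Variables (X : m.-tuple R) (Y : n.-tuple R).
Hypothesis size_lam : (size lam <= m + n)%N.

Let e := add_rho (m + n) lam.
Let Z := [tuple of X ++ Y].

(* In the Leibniz expansion of the alternant, each permutation survives in
   exactly one of these matrices as p ranges over the overlap pairs. *)
Definition laplace_mx (p : int_partition * int_partition) : 'M[R]_(m + n) :=
  \matrix_(i, j) (if (tnth e j \in add_rho m p.1) == (i < m)%N
                  then tnth Z i ^+ tnth e j else 0).

(** Up to the column permutation that sorts [rho_union], the matrix is block diagonal, with the
    matrices of the two smaller alternants as blocks. *)
Lemma det_laplace_mx p : p \in overlap_pairs m n lam ->
  \det (laplace_mx p) = (overlap_sign m n p.1 p.2)%:~R
    * alternant (add_rho m p.1) X * alternant (add_rho n p.2) Y.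
Proof.
rewrite inE => -[_ _ ov]; have /overlapP/andP[_ pe] := ov.
rewrite /overlap_sign ov; case: pickP => [s /eqP Es|]; last first.
  have /tuple_permP[s Es] := pe => /(_ s)/eqP[]; exact/val_inj.
have uu : uniq (rho_union m n p.1 p.2) by rewrite -(perm_uniq pe) add_rho_uniq.
have eE j : tnth e j = tnth (rho_union m n p.1 p.2) (s j).
  by rewrite /e -Es tnth_mktuple.
rewrite -mulrA /alternant -(det_ublock _ 0) rmorph_sign /=.
(* [col_perm s] is right multiplication by the matrix of [s^-1], which has the same sign as [s]. *)
rewrite -odd_permV -det_perm mulrC.
rewrite -det_mulmx -col_permE; congr (\det _).
apply/matrixP => i j; rewrite [RHS]mxE mxE eE.
case: (split_ordP (s j)) => k ->; rewrite ?tnth_lshift ?tnth_rshift.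
  rewrite mem_tnth; case: (split_ordP i) => l -> /=.
    by rewrite block_mxEul mxE tnth_lshift.
  by rewrite block_mxEdl mxE.
have -> : (tnth (add_rho n p.2) k \in add_rho m p.1) = false.
  move: uu; rewrite cat_uniq => /and3P[_ /hasPn h _]; apply/negbTE/h.
  exact: mem_tnth.
case: (split_ordP i) => l -> /=; first by rewrite block_mxEur mxE.
by rewrite block_mxEdr mxE tnth_rshift.
Qed.

(** The exponents that [s] assigns to the first [m] rows, once sorted, give [mu]; those of the other
    rows give [nu]. *)
Lemma overlap_pair_of_perm (s : 'S_(m + n)) :
  exists2 p, p \in overlap_pairs m n lam &
    forall i, (tnth e (s i) \in add_rho m p.1) = (i < m)%N.
Proof.
pose u := [tuple tnth e (s i) | i < m + n].
have pu : perm_eq u e by apply/tuple_permP; exists s.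
have uu : uniq u by rewrite (perm_uniq pu) add_rho_uniq.
pose t1 := [tuple tnth e (s (lshift n i)) | i < m].
pose t2 := [tuple tnth e (s (rshift m i)) | i < n].
have uE : u = [tuple of t1 ++ t2].
  apply: eq_from_tnth => i; rewrite tnth_mktuple.
  by case: (split_ordP i) => k ->; rewrite ?tnth_lshift ?tnth_rshift [RHS]tnth_mktuple.
move: uu; rewrite uE cat_uniq => /and3P[u1 /hasPn u12 u2].
have [mu smu pmu] := perm_add_rho u1; have [nu snu pnu] := perm_add_rho u2.
exists (mu, nu).
  rewrite inE; split=> //=; apply/overlapP; rewrite /is_overlap size_lam /=.
  by rewrite perm_sym in pu; apply: (perm_trans pu); rewrite uE; exact: perm_cat.
move=> i /=; rewrite -(perm_mem pmu); case: (split_ordP i) => k ->.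
  by apply/tnthP; exists k; rewrite (tnth_mktuple _ k).
apply/negbTE/u12.
by apply/tnthP; exists k; rewrite (tnth_mktuple _ k).
Qed.

Lemma overlap_pair_inj (s : 'S_(m + n)) p q :
    p \in overlap_pairs m n lam -> q \in overlap_pairs m n lam ->
    (forall i, (tnth e (s i) \in add_rho m p.1) = (i < m)%N) ->
    (forall i, (tnth e (s i) \in add_rho m q.1) = (i < m)%N) -> p = q.
Proof.
pose t1 := [tuple tnth e (s (lshift n i)) | i < m].
pose t2 := [tuple tnth e (s (rshift m i)) | i < n].
have e_inj : injective (tnth e).
  by apply/tuple_uniqP; exact: add_rho_uniq.
have u1 : uniq t1.
  apply/tuple_uniqP => i j; rewrite (tnth_mktuple _ i) (tnth_mktuple _ j).
  by move=> /e_inj/perm_inj/lshift_inj.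
have u2 : uniq t2.
  apply/tuple_uniqP => i j; rewrite (tnth_mktuple _ i) (tnth_mktuple _ j).
  by move=> /e_inj/perm_inj/rshift_inj.
have mem12 r : r \in overlap_pairs m n lam ->
    (forall i, (tnth e (s i) \in add_rho m r.1) = (i < m)%N) ->
    t1 =i add_rho m r.1 /\ t2 =i add_rho n r.2.
  rewrite inE => -[_ _ /overlapP/andP[_ pe]] h.
  (* Inclusion suffices, since the tuples have equal length and the left one has no repetition. *)
  split; apply: uniq_tuple_mem_eq => // _ /tnthP[i ->]; rewrite tnth_mktuple.
    by rewrite h /= ltn_ord.
  have := mem_tnth (s (rshift m i)) e; rewrite (perm_mem pe) mem_cat h /=.
  by rewrite ltnNge leq_addr.
case: p q => [p1 p2] [q1 q2] hp hq /(mem12 _ hp)[P1 P2] /(mem12 _ hq)[Q1 Q2].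
move: hp hq; rewrite !inE => -[/= sp1 sp2 _] [/= sq1 sq2 _].
by congr pair; [apply: (eq_add_rho_mem sp1 sq1)|apply: (eq_add_rho_mem sp2 sq2)];
  move=> x; rewrite -?P1 -?P2 -?Q1 -?Q2.
Qed.

(** Sum the determinants of [laplace_mx p] over all pairs and exchange the sums: for each
    permutation, one pair gives the full product and every other pair gives 0. *)
Lemma alternant_cat :
  alternant e Z = \sum_(p \in overlap_pairs m n lam)
    (overlap_sign m n p.1 p.2)%:~R
      * alternant (add_rho m p.1) X * alternant (add_rho n p.2) Y.
Proof.
rewrite fsbig_finite; last exact: finite_overlap_pairs.
have Dfin := finite_overlap_pairs m n lam.
transitivity (\sum_(p <- fset_set (overlap_pairs m n lam)) \det (laplace_mx p)).
  rewrite exchange_big; apply: eq_bigr => s _; rewrite -big_distrr /=.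
  congr (_ * _); have [p pD ps] := overlap_pair_of_perm s.
  rewrite (bigD1_seq p) /= ?in_fset_set //; last exact: fset_uniq.
  rewrite [X in _ + X]big1_seq => [|q].
    by rewrite addr0; apply: eq_bigr => i _; rewrite !mxE ps eqxx.
  rewrite in_fset_set // => /andP[qp qD].
  (* By uniqueness of the pair attached to [s], another pair [q] fails the membership test in some
     row, which yields a zero factor. *)
  have [i ne_i] : exists i, (tnth e (s i) \in add_rho m q.1) != (i < m)%N.
    apply/existsP; rewrite -negb_forall; apply: contra_neqN qp => /forallP h.
    by apply: (overlap_pair_inj (s := s)) => // i; apply/eqP.
  by rewrite (bigD1 i) //= !mxE (negbTE ne_i) mul0r.
apply: eq_big_seq => p; rewrite in_fset_set // => pD; exact: det_laplace_mx.
Qed.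

End Laplace.

Theorem corollary3p8 (F : fieldType) (lam : int_partition) (m n : nat)
    (S : m.-tuple F) (T : n.-tuple F) (hST : vdm2 S T != 0) :
  schur lam [tuple of S ++ T] =
  \sum_(p \in overlap_pairs m n lam)
    (overlap_sign m n p.1 p.2)%:~R * schur p.1 S * schur p.2 T / vdm2 S T.
Proof.
have Dfin := finite_overlap_pairs m n lam.
have [sl|sl] := leqP (size lam) (m + n); last first.
  (* If [lam] is too long, the left side is 0 by convention and no pair has overlap [lam]. *)
  rewrite /schur leqNgt sl /= fsbig1 // => p [_ _ /overlapP/andP[]].
  by rewrite leqNgt sl.
pose X : m.-tuple {mpoly F[m + n]} := [tuple 'X_(lshift n i) | i < m].
pose Y : n.-tuple {mpoly F[m + n]} := [tuple 'X_(rshift m i) | i < n].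
have XYE : [tuple of X ++ Y] = indeterminates F (m + n).
  apply: eq_from_tnth => i; rewrite [RHS]tnth_mktuple.
  by case: (split_ordP i) => k ->; rewrite ?tnth_lshift ?tnth_rshift [LHS]tnth_mktuple.
have vXY : vdm X * vdm Y != 0.
  have := vdm_indeterminates_neq0 F (m + n); rewrite -XYE vdm_cat.
  by apply: contra_neq => ->; rewrite mul0r.
pose Z := [tuple of X ++ Y].
(* The formula with [vdm2 X Y] cleared, obtained by cancelling [vdm X * vdm Y] in the polynomial
   ring. *)
have key : (schur_poly F (m + n) lam \mPo Z) * vdm2 X Y =
    \sum_(p <- fset_set (overlap_pairs m n lam)) (overlap_sign m n p.1 p.2)%:~R
      * (schur_poly F m p.1 \mPo X) * (schur_poly F n p.2 \mPo Y).
  apply: (mulIf vXY); rewrite -mulrA [vdm2 X Y * _]mulrC -vdm_cat schur_poly_comp.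
  rewrite alternant_cat // fsbig_finite // big_distrl; apply: eq_bigr => p _ /=.
  by rewrite -!schur_poly_comp [RHS]mulrACA !mulrA.
pose v := tnth [tuple of S ++ T].
have vX : map_tuple (meval v) X = S.
  by apply: eq_from_tnth => i; rewrite tnth_map tnth_mktuple mevalXU /v tnth_lshift.
have vY : map_tuple (meval v) Y = T.
  by apply: eq_from_tnth => i; rewrite tnth_map tnth_mktuple mevalXU /v tnth_rshift.
have vZ : map_tuple (meval v) Z = [tuple of S ++ T].
  by apply/val_inj; rewrite /= map_cat -vX -vY.
(* In [F] only [vdm2 S T] is cancelled, so [vdm S] and [vdm T] may vanish. *)
rewrite fsbig_finite //; apply: (mulIf hST); rewrite big_distrl /=.
have := congr1 (meval v) key.
rewrite rmorphM rmorph_vdm2 /= meval_schur_poly_comp // vX vY vZ => ->.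
rewrite rmorph_sum; apply: eq_big_seq => p; rewrite in_fset_set // inE => -[sp1 sp2 _].
by rewrite !rmorphM rmorph_int /= !meval_schur_poly_comp // vX vY divfK.
Qed.
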